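(* Let $l$ be a positive integer and let $G$ be the free group of rank $m$ with free basis $\{a_1,\dots,a_m\}$. For any $\phi\in S_l$ and any integer $n\ge1$, we have \[ \#W(\phi^n)\ge l^n m^n-2m. \]
   Context: $G$ is a free group of finite rank $m\ge1$ with a fixed free basis $\{a_1,\dots,a_m\}$; elements of $G$ are identified with reduced words in the letters $a_i^{\pm1}$. Remnant: an endomorphism $\phi:G\to G$ has remnant when, for each $i$, there is a nontrivial subword of (the reduced word) $\phi(a_i)$ which does not cancel in any product of the form $\phi(a_j)^{\pm1}\phi(a_i)\phi(a_k)^{\pm1}$, except for when $j$ or $k$ equals $i$ and the corresponding exponent is $-1$. The maximal such noncanceling subword of $\phi(a_i)$ is denoted $\mathrm{Rem}_\phi a_i$. It is known (Wagner) that if $\phi$ has remnant then so does every iterate $\phi^n$. For a generator $a_i$ and a reduced word $w$, $\Phi_{a_i}(w)$ is the number of times that $a_i$ or $a_i^{-1}$ appears in $w$. $S_l$ is the set of endomorphisms $\phi$ of $G$ (having remnant) such that $\Phi_{a_i}(\mathrm{Rem}_\phi a_j)\ge l$ for all generators $a_i,a_j$. Wagner tails of an endomorphism $\phi$: the pair $(1,1)$ is a Wagner tail. For each occurrence of a letter $a_i^{\epsilon}$ ($\epsilon\in\{+1,-1\}$) in $\phi(a_i)$, write the reduced product $\phi(a_i)=v a_i^{\epsilon}\bar v$; then $(w,\bar w)$ is a Wagner tail, where $w=v$ and $\bar w=\bar v^{-1}$ if $\epsilon=1$, while $w=va_i^{-1}$ and $\bar w=\bar v^{-1}a_i$ if $\epsilon=-1$.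 This tail is said to arise from the given occurrence of $a_i^\epsilon$; tails arising from different occurrences are regarded as different tails. $W(\phi)$: if $\phi$ has remnant and a Wagner tail arises from an occurrence of $a_i^{\pm1}$ in $\phi(a_i)$ which is an inside letter (not the first or last letter) of the subword $\mathrm{Rem}_\phi a_i$, the tail is said to occur inside the remnant. $W(\phi)$ is the set of Wagner tails of $\phi$ which occur inside the remnant. *)

(* Defs.v *)
From HB Require Import structures.
From mathcomp Require Import all_boot all_fingroup finmap.

Set Implicit Arguments.
Unset Strict Implicit.
Unset Printing Implicit Defensive.

Local Open Scope group_scope.

Section Words.

Variable m : nat.

(* [(i, true)] is the letter a_i and [(i, false)] is the letter a_i^-1. *)
Definition letter : Type := ('I_m * bool)%type.

Definition inv_letter (x : letter) : letter := (x.1, ~~ x.2).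

Definition reduced (w : seq letter) : bool :=
  sorted (fun x y => y != inv_letter x) w.

Definition push (x : letter) (w : seq letter) : seq letter :=
  if w is y :: w' then if y == inv_letter x then w' else x :: w else [:: x].

Definition reduce (w : seq letter) : seq letter := foldr push [::] w.

Definition inv_word (w : seq letter) : seq letter := rev (map inv_letter w).

Lemma inv_letterK : involutive inv_letter.
Proof. by case=> i b; rewrite /inv_letter /= negbK. Qed.

Lemma reduced_push x w : reduced w -> reduced (push x w).
Proof.
case: w => [//|y w] /=; case: eqP => [_|/eqP yx].
  exact: path_sorted.
by move=> h /=; rewrite yx h.
Qed.

Lemma foldr_push_reduced u v : reduced v -> reduced (foldr push v u).
Proof. by move=> rv; elim: u => //= x u IH; apply: reduced_push. Qed.

Lemma reduced_reduce w : reduced (reduce w).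
Proof. exact: foldr_push_reduced. Qed.

Lemma reduce_id w : reduced w -> reduce w = w.
Proof.
elim: w => //= x w IH xw; have /IH {IH} := path_sorted xw.
rewrite /reduce => ->; case: w xw => //= y w.
by case/andP=> /negbTE ->.
Qed.

Lemma push_invK x w : reduced w -> push x (push (inv_letter x) w) = w.
Proof.
case: w => [|y w] /=; first by rewrite eqxx.
rewrite inv_letterK; case: eqP => [->|_] rw; last by rewrite /= eqxx.
case: w rw => //= z w /andP[/negbTE nzx _].
by rewrite nzx.
Qed.

Lemma foldr_push_reduce u v :
  reduced v -> foldr push v (reduce u) = foldr push v u.
Proof.
move=> rv; elim: u => //= x u <-.
case def_r: (reduce u) => [//|y r] /=; case: eqP => [->|_] //.
by rewrite push_invK //; apply: foldr_push_reduced.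
Qed.

Lemma reduce_cat u v : reduce (u ++ v) = foldr push (reduce v) u.
Proof. exact: foldr_cat. Qed.

Lemma reduce_catl u v : reduce (reduce u ++ v) = reduce (u ++ v).
Proof. by rewrite !reduce_cat foldr_push_reduce ?reduced_reduce. Qed.

Lemma reduce_catr u v : reduce (u ++ reduce v) = reduce (u ++ v).
Proof. by rewrite !reduce_cat (reduce_id (reduced_reduce v)). Qed.

Lemma reduce_inv_cat w : reduce (inv_word w ++ w) = [::].
Proof.
rewrite /inv_word; elim: w => //= x w IH.
rewrite rev_cons cat_rcons reduce_cat /=.
rewrite -{2}(inv_letterK x) push_invK ?reduced_reduce //.
by rewrite -reduce_cat.
Qed.

Lemma inv_wordK : involutive inv_word.
Proof.
by move=> w; rewrite /inv_word map_rev revK mapK //; exact: inv_letterK.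
Qed.

Lemma reduce_cat_inv w : reduce (w ++ inv_word w) = [::].
Proof. by rewrite -{1}(inv_wordK w) reduce_inv_cat. Qed.

Record freeGroup := FreeGroup {
  word :> seq letter;
  word_reduced : reduced word
}.

HB.instance Definition _ := [isSub for word].
HB.instance Definition _ := [Choice of freeGroup by <:].

Definition fg (w : seq letter) : freeGroup := FreeGroup (reduced_reduce w).

Lemma fgA : associative (fun x y : freeGroup => fg (x ++ y)).
Proof.
move=> x y z; apply: val_inj => /=.
by rewrite reduce_catl reduce_catr catA.
Qed.

Lemma fg1l : left_id (fg [::]) (fun x y : freeGroup => fg (x ++ y)).
Proof. by move=> x; apply: val_inj; rewrite /= reduce_id ?word_reduced. Qed.

Lemma fg1r : right_id (fg [::]) (fun x y : freeGroup => fg (x ++ y)).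
Proof.
by move=> x; apply: val_inj; rewrite /= cats0 reduce_id ?word_reduced.
Qed.

Lemma fgVl :
  left_inverse (fg [::]) (fun x : freeGroup => fg (inv_word x))
    (fun x y => fg (x ++ y)).
Proof.
by move=> x; apply: val_inj; rewrite /= reduce_catl reduce_inv_cat.
Qed.

Lemma fgVr :
  right_inverse (fg [::]) (fun x : freeGroup => fg (inv_word x))
    (fun x y => fg (x ++ y)).
Proof.
by move=> x; apply: val_inj; rewrite /= reduce_catr reduce_cat_inv.
Qed.

HB.instance Definition _ := isGroup.Build freeGroup fgA fg1l fg1r fgVl fgVr.

Lemma fgK (x : freeGroup) : fg x = x.
Proof. by apply: val_inj; rewrite /= reduce_id ?word_reduced. Qed.

Lemma fg_cat u v : fg (u ++ v) = fg u * fg v.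
Proof. by apply: val_inj; rewrite /= reduce_catl reduce_catr. Qed.

Lemma reduced_catl u v : reduced (u ++ v) -> reduced u.
Proof. by case/cat_sorted2. Qed.

Lemma reduced_catr u v : reduced (u ++ v) -> reduced v.
Proof. by case/cat_sorted2. Qed.

Lemma reduced_glue u v w :
  v != [::] -> reduced (u ++ v) -> reduced (v ++ w) -> reduced (u ++ v ++ w).
Proof.
case: v => // y v _; elim: u => //= x [|z u] IH /=.
  by case/andP=> -> _ ->.
by case/andP=> -> h1 h2; apply: IH.
Qed.

Definition gen (i : 'I_m) : freeGroup := fg [:: (i, true)].

End Words.

Definition endo (m : nat) : Type := {multiplicative freeGroup m -> freeGroup m}.

Section Iterate.

Variables (m : nat) (phi : endo m) (n : nat).

Lemma iter_mul : {morph iter n phi : x y / x * y}.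
Proof. by move=> x y; elim: n => //= k ->; rewrite gmulfM. Qed.

HB.instance Definition _ :=
  isMultiplicative.Build (freeGroup m) (freeGroup m) (iter n phi) iter_mul.

Definition endo_iter : endo m := iter n phi.

End Iterate.

Section Remnant.

Variables (m : nat) (phi : endo m).

Definition spow (x : freeGroup m) (e : bool) : freeGroup m :=
  if e then x else x^-1.

Definition subword (p q : nat) (w : seq (letter m)) : seq (letter m) :=
  take (q - p) (drop p w).

(* The subword of [v] on the positions p, ..., q - 1 does not cancel in
   x * v * y: the reduced word of this product consists of that subword,
   preceded (resp. followed) by the reduced word of what lies to its left
   (resp. right). *)
Definition survives (x v y : freeGroup m) (p q : nat) : bool :=
  word (x * v * y) ==
    word (x * fg (take p v)) ++ subword p q v ++ word (fg (drop q v) * y).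

Definition noncanceling (i : 'I_m) (p q : nat) : bool :=
  [&& p < q, q <= size (phi (gen i)) &
    [forall j : 'I_m, forall k : 'I_m, forall d : bool, forall e : bool,
      ((j, d) != (i, false)) && ((k, e) != (i, false)) ==>
      survives (spow (phi (gen j)) d) (phi (gen i)) (spow (phi (gen k)) e)
        p q]].

Lemma survivesE (x v y : freeGroup m) p q : p < q -> q <= size v ->
  survives x v y p q = reduced (word (x * fg (take p v)) ++ drop p v) &&
                       reduced (take q v ++ word (fg (drop q v) * y)).
Proof.
move=> ltpq leqv; have lepq := ltnW ltpq.
have Dp : drop p v = subword p q v ++ drop q v.
  by rewrite /subword -{1}(cat_take_drop (q - p) (drop p v)) drop_drop subnK.
have Dq : take q v = take p v ++ subword p q v.
  rewrite /subword take_drop subnK // -{1}(cat_take_drop p (take q v)).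
  by rewrite take_takel.
have s_n0 : subword p q v != [::].
  rewrite -size_eq0 /subword size_takel ?subn_eq0 -?ltnNge //.
  by rewrite size_drop leq_sub2r.
have rv := word_reduced v; rewrite /survives.
set A := word (x * fg _); set B := word (fg _ * y).
apply/eqP/andP => [E|[rA rB]].
  have := word_reduced (x * v * y); rewrite E => rE; split.
    rewrite Dp; apply: reduced_glue => //.
      by apply: (@reduced_catl _ _ B); rewrite -catA.
    by apply: (@reduced_catr _ (take p v)); rewrite -Dp cat_take_drop.
  rewrite Dq -catA; apply: reduced_glue => //; last exact: reduced_catr rE.
  by apply: (@reduced_catl _ _ (drop q v)); rewrite -Dq cat_take_drop.
have rE : reduced (A ++ subword p q v ++ B).
  apply: reduced_glue => //.
    by move: rA; rewrite Dp catA; apply: reduced_catl.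
  by move: rB; rewrite Dq -catA; apply: reduced_catr.
rewrite -[RHS](reduce_id rE) -[RHS]/(word (fg _)) !fg_cat !fgK; congr word.
rewrite -{1}(fgK v) -{1}(cat_take_drop p v) Dp !fg_cat.
by rewrite !mulgA.
Qed.

Lemma noncanceling_join i p q p' q' :
  noncanceling i p q -> noncanceling i p' q' ->
  noncanceling i (minn p p') (maxn q q').
Proof.
case/and3P=> pq qs H /and3P[pq' qs' H'].
have lt : minn p p' < maxn q q' by rewrite gtn_min leq_max pq.
have le : maxn q q' <= size (phi (gen i)) by rewrite geq_max qs.
rewrite /noncanceling lt le /=.
apply/forallP=> j; apply/forallP=> k; apply/forallP=> d; apply/forallP=> e.
move/forallP/(_ j)/forallP/(_ k)/forallP/(_ d)/forallP/(_ e): H.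
move/forallP/(_ j)/forallP/(_ k)/forallP/(_ d)/forallP/(_ e): H'.
case: (_ && _) => //=; rewrite !survivesE // => /andP[a b] /andP[a' b'].
by rewrite /minn /maxn; case: ifP => _; case: ifP => _; apply/andP.
Qed.

Definition position (i : 'I_m) : Type := 'I_(size (phi (gen i))).+1.

Definition has_remnant : bool :=
  [forall i : 'I_m, exists p : position i, exists q : position i,
    noncanceling i p q].

Definition maximal_noncanceling (i : 'I_m) (p q : nat) : bool :=
  noncanceling i p q &&
    [forall p' : position i, forall q' : position i,
      [&& noncanceling i p' q', p' <= p & q <= q'] ==>
        (p' == p :> nat) && (q' == q :> nat)].

Lemma maximal_noncanceling_unique i p q p' q' :
  maximal_noncanceling i p q -> maximal_noncanceling i p' q' ->
  p = p' /\ q = q'.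
Proof.
case/andP=> N /forallP M /andP[N' /forallP M'].
have NJ := noncanceling_join N N'; case/and3P: (NJ) => lt le _.
pose P : position i := Ordinal (leq_trans (ltnW lt) le : _ < _.+1).
pose Q : position i := Ordinal (le : _ < _.+1).
move/(_ P)/forallP/(_ Q): M; move/(_ P)/forallP/(_ Q): M'.
rewrite /= NJ !geq_minl !geq_minr !leq_maxl !leq_maxr /=.
by case/andP=> /eqP -> /eqP -> /andP[/eqP -> /eqP ->].
Qed.

(* End positions in phi(a_i) of the maximal noncanceling subword, which is
   unique by [maximal_noncanceling_unique]; (0, 0) if there is none. *)
Definition Rem_pos (i : 'I_m) : nat * nat :=
  if [pick pq : position i * position i | maximal_noncanceling i pq.1 pq.2]
    is Some pq then (nat_of_ord pq.1, nat_of_ord pq.2) else (0, 0).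

Definition Rem (i : 'I_m) : seq (letter m) :=
  subword (Rem_pos i).1 (Rem_pos i).2 (phi (gen i)).

Definition occ_count (i : 'I_m) (w : seq (letter m)) : nat :=
  count (fun x => x.1 == i) w.

End Remnant.

Definition Sset (m l : nat) : {pred endo m} :=
  fun phi => has_remnant phi &&
    [forall i : 'I_m, forall j : 'I_m, l <= occ_count i (Rem phi j)].

Section WagnerTails.

Local Open Scope fset_scope.

Variables (m : nat) (phi : endo m).

(* (i, k) : the letter at position k of phi(a_i) is a_i or a_i^-1. *)
Definition self_occs : {fset 'I_m * nat} :=
  [fset o in [seq (i, k) | i <- enum 'I_m, k <- iota 0 (size (phi (gen i)))] |
    (nth (o.1, true) (phi (gen o.1)) o.2).1 == o.1].

Definition tail_at (o : 'I_m * nat) : freeGroup m * freeGroup m :=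
  let: (i, k) := o in
  let v := fg (take k (phi (gen i))) in
  let v' := fg (drop k.+1 (phi (gen i))) in
  if (nth (i, true) (phi (gen i)) k).2 then (v, v'^-1)
  else (v * (gen i)^-1, v'^-1 * gen i).

(* A Wagner tail is labelled by the occurrence from which it arises (None for
   the tail (1, 1)), so that tails from different occurrences are different. *)
Definition wagner_tails :
    {fset option ('I_m * nat) * (freeGroup m * freeGroup m)} :=
  (None, (1, 1)) |` [fset (Some o, tail_at o) | o in self_occs].

Definition inside_remnant
    (t : option ('I_m * nat) * (freeGroup m * freeGroup m)) : bool :=
  if t.1 is Some (i, k) then
    [&& has_remnant phi, (Rem_pos phi i).1 < k & k.+1 < (Rem_pos phi i).2]
  else false.

Definition W : {fset option ('I_m * nat) * (freeGroup m * freeGroup m)} :=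
  [fset t in wagner_tails | inside_remnant t].

End WagnerTails.

(* Main.v *)
(** Let R_c be the remnant of phi inside phi(c), for a letter c = a_i^{+-1}
    (inverted when c = a_i^{-1}), and phi(c) = U_c R_c V_c.  The cancellation
    between phi(c) and phi(d), for c d reduced, stays inside V_c U_d; as no R_c
    is empty, the reduced image of c_1 ... c_r is
    U_{c_1} R_{c_1} red(V_{c_1} U_{c_2}) R_{c_2} ... R_{c_r} V_{c_r}.
    Hence the images of the letters of Rem_psi a_j keep their remnants in every
    product testing the remnant of phi o psi, and phi \in S_l, psi \in S_k give
    phi o psi \in S_{lmk}.  Thus phi^n \in S_{l^n m^{n-1}}; summing the
    occurrences of a_i in Rem a_i over i gives l^n m^n, of which at most two per
    generator (the end letters) are not inside the remnant. *)

Require Import Defs.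
From mathcomp Require Import all_boot all_fingroup finmap zify.

Set Implicit Arguments.
Unset Strict Implicit.
Unset Printing Implicit Defensive.

(** * Reduced words: inverses, letter counts and cancellation at a junction *)

Section Words.

Local Open Scope group_scope.
Variable m : nat.
Implicit Types (u v w : seq (letter m)) (x y : freeGroup m).

Lemma inv_word_cat u v : inv_word (u ++ v) = inv_word v ++ inv_word u.
Proof. by rewrite /inv_word map_cat rev_cat. Qed.

Lemma inv_word1 (c : letter m) : inv_word [:: c] = [:: inv_letter c].
Proof. by []. Qed.

Lemma reduced_inv w : reduced (inv_word w) = reduced w.
Proof.
rewrite /reduced /inv_word rev_sorted sorted_map; apply: eq_sorted => a b /=.
by rewrite inv_letterK eq_sym -(inj_eq (can_inj (@inv_letterK m))) inv_letterK.
Qed.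

Lemma word_inv x : word x^-1 = inv_word x.
Proof. by rewrite [LHS]/= reduce_id // reduced_inv word_reduced. Qed.

Lemma fg_inv w : fg (inv_word w) = (fg w)^-1.
Proof.
apply: (mulIg (fg w)); rewrite mulVg -fg_cat; apply: val_inj.
exact: reduce_inv_cat.
Qed.

Lemma word_fg w : reduced w -> word (fg w) = w.
Proof. exact: reduce_id. Qed.

Lemma count_inv_word (i : 'I_m) w : occ_count i (inv_word w) = occ_count i w.
Proof. by rewrite /occ_count /inv_word count_rev count_map. Qed.

(** Each letter, whatever its sign, is counted for exactly one generator, so exchanging the two sums
    leaves one per letter. *)
Lemma sum_occ_count w : \sum_(i < m) occ_count i w = size w.
Proof.
rewrite -[RHS]sum1_size -[LHS]/(\sum_i count _ w).
under eq_bigr => i _ do rewrite -sum1_count big_mkcond /=.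
rewrite exchange_big; apply: eq_bigr => a _ /=.
by rewrite -big_mkcond /= (eq_bigl (pred1 a.1)) ?big_pred1_eq // => i; rewrite eq_sym.
Qed.

(* If the cancellation in [V ++ U] used up one of the two factors, the
   corresponding hypothesis on a triple product would already be the claim. *)
Lemma reduced_junction (P V U Q : seq (letter m)) :
    reduced (P ++ V) -> reduced (U ++ Q) ->
    reduced (P ++ reduce (V ++ U ++ Q)) -> reduced (reduce (P ++ V ++ U) ++ Q) ->
  reduced (P ++ reduce (V ++ U) ++ Q).
Proof.
elim/last_ind: V U => [|V a IH] U rPV rUQ rR rL.
  by move: rR; rewrite /= (reduce_id rUQ) (reduce_id (reduced_catl rUQ)).
case: U rUQ rR rL => [|b U] rUQ rR rL.
  move: rL; rewrite !cats0 (reduce_id rPV) (reduce_id (reduced_catr rPV)).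
  by rewrite catA.
(* A cancelling pair drops out of all the products involved, which leaves the shorter [V] and [U] to
   the induction hypothesis; if [a] and [b] do not cancel, nothing in the concatenation does. *)
have [Db | ab] := eqVneq b (inv_letter a).
  have red2 w : reduce (rcons V a ++ b :: w) = reduce (V ++ w).
    rewrite cat_rcons Db !reduce_cat; congr foldr; rewrite /=.
    by rewrite push_invK ?reduced_reduce.
  have red3 w : reduce (P ++ rcons V a ++ b :: w) = reduce (P ++ V ++ w).
    by rewrite -reduce_catr red2 reduce_catr.
  rewrite red2; move: rR rL; rewrite cat_cons red2 red3 => rR rL.
  apply: IH => //; first by move: rPV; rewrite -cats1 catA; apply: reduced_catl.
  exact: path_sorted rUQ.
have rab : reduced ([:: a] ++ [:: b]) by rewrite /reduced /= ab.
rewrite reduce_id.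
  rewrite -cats1 -!catA catA.
  apply: (reduced_glue (v := [:: a])) => //; first by rewrite -catA cats1.
  by move: rUQ => /= ->; rewrite ab.
rewrite -cats1 -catA.
apply: (reduced_glue (v := [:: a])) => //.
  by rewrite cats1; apply: reduced_catr rPV.
have := @reduced_catl _ (b :: U) Q rUQ.
by rewrite /reduced /= ab.
Qed.

Lemma endo1 (phi : endo m) : phi 1 = 1.
Proof. by apply: (mulgI (phi 1)); rewrite -gmulfM !mulg1. Qed.

Lemma endoV (phi : endo m) x : phi x^-1 = (phi x)^-1.
Proof. by apply: (mulgI (phi x)); rewrite -gmulfM !mulgV endo1. Qed.

End Words.

(** * Images of reduced words when every letter has a core that survives *)

Section Factorization.

Local Open Scope group_scope.

Variables (m : nat) (phi : endo m) (U R V : letter m -> seq (letter m)).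

Hypothesis phiE : forall c, word (phi (fg [:: c])) = U c ++ R c ++ V c.
Hypothesis R_neq0 : forall c, R c != [::].
Hypothesis junction : forall c d, d != inv_letter c ->
  reduced (R c ++ reduce (V c ++ U d) ++ R d).

Implicit Types (c d : letter m) (w T D : seq (letter m)).

(** In the image of a reduced word T c D, [image_before T c] and [image_after c D] are what stands
    to the left and to the right of R_c, after cancellation. *)
Definition image_before T c : seq (letter m) := word (phi (fg T) * fg (U c)).

Definition image_after c D : seq (letter m) := word (fg (V c) * phi (fg D)).

(** The image of c w from its first R to its last R; it depends on c w alone, not on the word around
    it. *)
Fixpoint image_core c w : seq (letter m) :=
  R c ++ (if w is d :: w' then reduce (V c ++ U d) ++ image_core d w' else [::]).

Lemma fg_phiE c : phi (fg [:: c]) = fg (U c) * fg (R c) * fg (V c).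
Proof. by rewrite -[LHS]fgK phiE !fg_cat mulgA. Qed.

Lemma fg_reduce w : fg (reduce w) = fg w.
Proof. by apply: val_inj; rewrite /= reduce_id ?reduced_reduce. Qed.

Lemma fg_nil : fg [::] = 1 :> freeGroup m.
Proof. by []. Qed.

Lemma fg_cons c w : fg (c :: w) = fg [:: c] * fg w.
Proof. by rewrite -cat1s fg_cat. Qed.

Lemma fg_rcons w c : fg (rcons w c) = fg w * fg [:: c].
Proof. by rewrite -cats1 fg_cat. Qed.

(** Both sides represent the same group element, and the right one is reduced: R_d is nonempty, so
    the junction before it and the word after it can be glued along it. *)
Lemma image_after_cons c d w : d != inv_letter c ->
    reduced (R d ++ image_after d w) ->
  image_after c (d :: w) = reduce (V c ++ U d) ++ R d ++ image_after d w.
Proof.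
move=> cd rd; rewrite -[RHS]word_fg; last first.
  exact: reduced_glue (R_neq0 d) (reduced_catr (junction cd)) rd.
rewrite /image_after fg_cons gmulfM fg_phiE !fg_cat fg_reduce fg_cat fgK.
by rewrite !mulgA.
Qed.

Lemma reduced_image_after c w :
  reduced (c :: w) -> reduced (R c ++ image_after c w).
Proof.
elim: w c => [|d w IH] c.
  have := word_reduced (phi (fg [:: c])); rewrite phiE => /reduced_catr.
  rewrite /image_after fg_nil endo1 mulg1 => rc _.
  by rewrite word_fg // (reduced_catr rc).
case/andP=> cd /IH rd; rewrite image_after_cons // catA.
by apply: (reduced_glue (R_neq0 d)); rewrite // -catA junction.
Qed.

Lemma image_before_rcons b c T : c != inv_letter b ->
    reduced (image_before T b ++ R b) ->
  image_before (rcons T b) c = image_before T b ++ R b ++ reduce (V b ++ U c).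
Proof.
move=> bc rb; rewrite -[RHS]word_fg; last first.
  apply: (reduced_glue (R_neq0 b)) => //.
  by have := junction bc; rewrite catA; apply: reduced_catl.
rewrite /image_before fg_rcons gmulfM fg_phiE !fg_cat fg_reduce fg_cat fgK.
by rewrite !mulgA.
Qed.

Lemma reduced_image_before T c :
  reduced (rcons T c) -> reduced (image_before T c ++ R c).
Proof.
elim/last_ind: T c => [|T b IH] c rT.
  have := word_reduced (phi (fg [:: c])); rewrite phiE catA => /reduced_catl.
  rewrite /image_before fg_nil endo1 mul1g => rc.
  by rewrite word_fg // (reduced_catl rc).
have bc : c != inv_letter b.
  move: rT; rewrite -!cats1 -catA => /reduced_catr.
  by rewrite /reduced /= andbT.
have {}IH := IH b (reduced_catl (_ : reduced (rcons T b ++ [:: c]))).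
rewrite cats1 in IH; have {}IH := IH rT.
rewrite image_before_rcons // -!catA.
by apply: (reduced_glue (R_neq0 b)); rewrite // junction.
Qed.

Lemma image_core_after c w D : reduced (c :: w ++ D) ->
  R c ++ image_after c (w ++ D) = image_core c w ++ image_after (last c w) D.
Proof.
elim: w c => [|d w IH] c /=; first by rewrite cats0.
case/andP=> cd rd; rewrite image_after_cons ?reduced_image_after //.
by rewrite IH // -!catA.
Qed.

(** The context T, D affects only the two outer factors, so the same core appears in the image of
    every reduced word containing c w. *)
Lemma image_factor T c w D : reduced (T ++ (c :: w) ++ D) ->
  word (phi (fg (T ++ (c :: w) ++ D))) =
    image_before T c ++ image_core c w ++ image_after (last c w) D.
Proof.
move=> rw; rewrite -image_core_after; last exact: reduced_catr rw.
rewrite -[RHS]word_fg.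
  rewrite cat_cons fg_cat fg_cons gmulfM [phi (fg [:: c] * _)]gmulfM fg_phiE.
  by rewrite !fg_cat !fgK fg_cat !mulgA.
apply: (reduced_glue (R_neq0 c)).
  apply: reduced_image_before; move: rw; rewrite catA -cat_rcons -catA.
  exact: reduced_catl.
exact: reduced_image_after (reduced_catr rw).
Qed.

Lemma image_core_neq0 c w : image_core c w != [::].
Proof. by case: w (R_neq0 c) => [|d w] /=; case: (R c). Qed.

Lemma leq_occ_image_core l i c w : (forall d, l <= occ_count i (R d)) ->
  l * (size w).+1 <= occ_count i (image_core c w).
Proof.
move=> lR; elim: w c => [|d w IH] c /=; rewrite /occ_count !count_cat.
  by rewrite muln1 addn0 lR.
have := lR c; have := IH d; rewrite /occ_count; lia.
Qed.

(** A product testing [chi] is the image under [phi] of the corresponding product testing [psi].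
    There c w survives, so by [image_factor] its core survives in the image. *)
Lemma noncanceling_comp (psi chi : endo m) j p q :
    (forall x, chi x = phi (psi x)) -> noncanceling psi j p q ->
  exists p' q' c w, [/\ noncanceling chi j p' q',
    subword p q (psi (gen j)) = c :: w &
    subword p' q' (chi (gen j)) = image_core c w].
Proof.
move=> chiE /and3P[pq qs H].
set v := psi (gen j) in qs H *.
have Dv : word v = take p v ++ subword p q v ++ drop q v.
  rewrite -[LHS](cat_take_drop p); congr (_ ++ _).
  rewrite /subword -[LHS](cat_take_drop (q - p)) drop_drop subnK //.
  exact: ltnW.
case Ds: (subword p q v) => [|c w].
  move/(congr1 size): Ds; rewrite /subword size_takel ?size_drop //= ; lia.
rewrite Ds in Dv; set T := take p v in Dv *; set D := drop q v in Dv *.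
have Dchi : word (chi (gen j)) =
    image_before T c ++ image_core c w ++ image_after (last c w) D.
  rewrite chiE -/v -(fgK v) Dv image_factor // -Dv; exact: word_reduced.
(* The end positions of the core in chi(a_j). *)
exists (size (image_before T c)).
exists (size (image_before T c) + size (image_core c w)), c, w; split=> //.
  rewrite /noncanceling Dchi; apply/and3P; split.
  - by rewrite -[X in X < _]addn0 ltn_add2l lt0n size_eq0 image_core_neq0.
  - by rewrite !size_cat addnA leq_addr.
  apply/forallP=> j1; apply/forallP=> j2; apply/forallP=> e1; apply/forallP=> e2.
  have:= H; move=> /forallP/(_ j1)/forallP/(_ j2)/forallP/(_ e1)/forallP/(_ e2).
  case: (_ && _) => //=; rewrite /survives Ds -/T -/D => /eqP E.
  have spowE k e : spow (chi (gen k)) e = phi (spow (psi (gen k)) e).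
    by case: e; rewrite /= chiE // endoV.
  rewrite !spowE; set x := spow _ e1 in E *; set y := spow _ e2 in E *.
  rewrite /subword Dchi take_size_cat // addKn drop_size_cat // take_size_cat //.
  rewrite [X in drop _ X]catA drop_size_cat ?size_cat // chiE -/v.
  (* [E] exhibits c w inside the reduced word of x v y, so [image_factor] applies a second time,
     with a new context. *)
  rewrite -!gmulfM -(fgK (_ * v * _)) E.
  rewrite image_factor -?E ?word_reduced //; apply/eqP.
  rewrite /image_before /image_after !fgK !gmulfM.
  by rewrite !mulgA.
by rewrite /subword Dchi drop_size_cat // addKn take_size_cat.
Qed.

End Factorization.

(** * The maximal noncanceling subword and its junctions *)

Section Remnant.

Local Open Scope group_scope.

Variables (m : nat) (phi : endo m).

(** A longest noncanceling subword among those containing the given one is maximal, hence by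
    uniqueness the one picked in [Rem_pos]; the default (0, 0) does not occur. *)
Lemma noncanceling_Rem_pos i p q : noncanceling phi i p q ->
  [/\ maximal_noncanceling phi i (Rem_pos phi i).1 (Rem_pos phi i).2,
      (Rem_pos phi i).1 <= p & q <= (Rem_pos phi i).2].
Proof.
move=> N; have /and3P[ltpq leq _] := N.
pose P : position phi i := Ordinal (leq_trans (ltnW ltpq) leq : _ < _.+1).
pose Q : position phi i := Ordinal (leq : _ < _.+1).
pose good (r : position phi i * position phi i) :=
  [&& noncanceling phi i r.1 r.2, r.1 <= p & q <= r.2].
have goodPQ : good (P, Q) by rewrite /good N !leqnn.
have [[p' q'] /and3P[/= N' p'p qq'] max] :=
  arg_maxnP (fun r : position phi i * position phi i => r.2 - r.1) goodPQ.
have M : maximal_noncanceling phi i p' q'.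
  rewrite /maximal_noncanceling N'; apply/forallP=> p2; apply/forallP=> q2.
  apply/implyP=> /and3P[N2 p2p' q'q2].
  have /max /= : good (p2, q2).
    by rewrite /good N2 (leq_trans p2p') // (leq_trans qq').
  case/and3P: N' => ? _ _; case/and3P: N2 => ? _ _; lia.
rewrite /Rem_pos; case: pickP => [[p3 q3] /= M3 | /(_ (p', q'))]; last by rewrite M.
by have [-> ->] := maximal_noncanceling_unique M3 M.
Qed.

Lemma occ_count_Rem i j p q : noncanceling phi j p q ->
  occ_count i (subword p q (phi (gen j))) <= occ_count i (Rem phi j).
Proof.
move=> N; have /and3P[/ltnW pq _ _] := N.
case/noncanceling_Rem_pos: N => _; rewrite /Rem /subword /occ_count.
set P := _.1; set Q := _.2 => Pp qQ.
have -> : Q - P = p - P + (q - p + (Q - q)) by lia.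
rewrite takeD drop_drop subnK // takeD !count_cat; lia.
Qed.

Hypothesis remP : has_remnant phi.

Lemma maximal_Rem_pos i :
  maximal_noncanceling phi i (Rem_pos phi i).1 (Rem_pos phi i).2.
Proof.
move/forallP/(_ i)/existsP: remP => [p /existsP[q N]].
by have [] := noncanceling_Rem_pos N.
Qed.

Lemma noncanceling_Rem i :
  noncanceling phi i (Rem_pos phi i).1 (Rem_pos phi i).2.
Proof. by case/andP: (maximal_Rem_pos i). Qed.

(** [before_Rem], [Rem_letter] and [after_Rem] instantiate U, R and V. For an inverse letter the
    image is inverted, so prefix and suffix change places. *)
Definition before_Rem (c : letter m) : seq (letter m) :=
  let v := phi (gen c.1) in
  if c.2 then take (Rem_pos phi c.1).1 v
  else inv_word (drop (Rem_pos phi c.1).2 v).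

Definition Rem_letter (c : letter m) : seq (letter m) :=
  if c.2 then Rem phi c.1 else inv_word (Rem phi c.1).

Definition after_Rem (c : letter m) : seq (letter m) :=
  inv_word (before_Rem (inv_letter c)).

Lemma phi_gen_cat i : word (phi (gen i)) =
  take (Rem_pos phi i).1 (phi (gen i)) ++ Rem phi i ++
    drop (Rem_pos phi i).2 (phi (gen i)).
Proof.
have /and3P[lt _ _] := noncanceling_Rem i.
rewrite -[LHS](cat_take_drop (Rem_pos phi i).1); congr (_ ++ _).
rewrite /Rem /subword -[LHS](cat_take_drop ((Rem_pos phi i).2 - (Rem_pos phi i).1)).
by rewrite drop_drop subnK // ltnW.
Qed.

Lemma spow_gen (i : 'I_m) e : spow (gen i) e = fg [:: (i, e)].
Proof. by case: e => //=; rewrite -fg_inv. Qed.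

Lemma spow_phi_gen (i : 'I_m) e : spow (phi (gen i)) e = phi (fg [:: (i, e)]).
Proof. by rewrite -spow_gen; case: e => //=; rewrite endoV. Qed.

Lemma phi_letterE c :
  word (phi (fg [:: c])) = before_Rem c ++ Rem_letter c ++ after_Rem c.
Proof.
case: c => i []; rewrite -spow_phi_gen /spow.
  by rewrite /after_Rem /= inv_wordK -phi_gen_cat.
by rewrite word_inv [in LHS]phi_gen_cat !inv_word_cat -catA.
Qed.

Lemma Rem_letter_neq0 c : Rem_letter c != [::].
Proof.
have /and3P[lt le _] := noncanceling_Rem c.1.
have: size (Rem phi c.1) != 0.
  by rewrite /Rem /subword size_takel ?size_drop ?leq_sub2r // -lt0n subn_gt0.
rewrite -size_eq0 /Rem_letter; case: (c.2) => //.
by rewrite /inv_word size_rev size_map.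
Qed.

(** For c = a_i this is the right half of a test with right factor phi(d). For c = a_i^-1 it is the
    inverse of the left half of a test with left factor phi(d)^-1. *)
Lemma reduced_right c d : d != inv_letter c ->
  reduced (before_Rem c ++ Rem_letter c ++ word (fg (after_Rem c) * phi (fg [:: d]))).
Proof.
case: c d => i e [k f] cd; rewrite /after_Rem /before_Rem /Rem_letter /=.
have /and3P[lt le H] := noncanceling_Rem i.
case: e cd => /= cd.
  (* The factor on the other side is taken to be phi(a_i), which is never an excluded case. *)
  move: H => /forallP/(_ i)/forallP/(_ k)/forallP/(_ true)/forallP/(_ f).
  rewrite [(i, true) == _]xpair_eqE andbF cd /= survivesE // spow_phi_gen.
  case/andP=> _; rewrite inv_wordK.
  suff -> : take (Rem_pos phi i).2 (phi (gen i)) =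
      take (Rem_pos phi i).1 (phi (gen i)) ++ Rem phi i by rewrite -catA.
  by rewrite /Rem /subword -takeD subnKC // ltnW.
move: H => /forallP/(_ k)/forallP/(_ i)/forallP/(_ (~~ f))/forallP/(_ true).
rewrite [(i, true) == _]xpair_eqE andbF andbT.
have -> : (k, ~~ f) != (i, false).
  by apply: contra cd; rewrite !xpair_eqE; case: (f).
rewrite survivesE // => /andP[+ _]; rewrite -reduced_inv inv_word_cat -word_inv.
rewrite invMg -fg_inv.
have -> : drop (Rem_pos phi i).1 (phi (gen i)) =
    Rem phi i ++ drop (Rem_pos phi i).2 (phi (gen i)).
  rewrite {1}phi_gen_cat drop_size_cat // size_takel //.
  exact: leq_trans (ltnW lt) le.
rewrite inv_word_cat -catA spow_phi_gen -endoV -fg_inv.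
by rewrite inv_word1 /inv_letter negbK.
Qed.

Lemma before_Rem_inv c : before_Rem c = inv_word (after_Rem (inv_letter c)).
Proof. by rewrite /after_Rem inv_letterK inv_wordK. Qed.

Lemma Rem_letter_inv c : Rem_letter (inv_letter c) = inv_word (Rem_letter c).
Proof. by case: c => i []; rewrite /Rem_letter //= inv_wordK. Qed.

(** The definition makes R_c survive against all of phi(d), and R_d against all of phi(c);
    [reduced_junction] shows that both survive at once. *)
Lemma Rem_letter_junction c d : d != inv_letter c ->
  reduced (Rem_letter c ++ reduce (after_Rem c ++ before_Rem d) ++ Rem_letter d).
Proof.
move=> cd.
have := word_reduced (phi (fg [:: c])); rewrite phi_letterE => rc.
have := word_reduced (phi (fg [:: d])); rewrite phi_letterE => rd.
have wE x y : word (phi (fg [:: x]) * fg y) =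
    reduce (before_Rem x ++ Rem_letter x ++ after_Rem x ++ y).
  by rewrite -[phi _]fgK phi_letterE -fg_cat -!catA.
have right := reduced_right cd.
(* The mirror image of [right]: [reduced_right] for d^-1 followed by c^-1, then inverted. *)
have left : reduced (word (phi (fg [:: c]) * fg (before_Rem d)) ++
    Rem_letter d ++ after_Rem d).
  have /reduced_right : inv_letter c != inv_letter (inv_letter d).
    by rewrite inv_letterK eq_sym.
  rewrite -reduced_inv !inv_word_cat -word_inv invMg -!fg_inv -before_Rem_inv.
  rewrite Rem_letter_inv inv_wordK -endoV -fg_inv -catA.
  by rewrite inv_word1 inv_letterK.
have := reduced_junction (P := before_Rem c ++ Rem_letter c) (V := after_Rem c)
  (U := before_Rem d) (Q := Rem_letter d ++ after_Rem d).
rewrite -!catA -wE => /(_ rc rd).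
have -> : reduce (after_Rem c ++ before_Rem d ++ Rem_letter d ++ after_Rem d) =
    word (fg (after_Rem c) * phi (fg [:: d])).
  by rewrite -[phi _]fgK phi_letterE -fg_cat.
move=> /(_ right left) /reduced_catr; rewrite !catA; exact: reduced_catl.
Qed.

End Remnant.

(** * Occurrence bounds under composition and iteration *)

Lemma Sset_comp m l k (phi psi chi : endo m) :
    (forall x, chi x = phi (psi x)) -> phi \in Sset l -> psi \in Sset k ->
  chi \in Sset (l * (m * k)).
Proof.
move=> chiE /andP[remphi Sphi] /andP[rempsi Spsi].
have core j := noncanceling_comp (phi_letterE remphi) (Rem_letter_neq0 remphi)
  (Rem_letter_junction remphi) chiE (noncanceling_Rem rempsi j).
apply/andP; split.
  apply/forallP=> j; have [p [q [_ [_ [N _ _]]]]] := core j.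
  have [/andP[N' _] _ _] := noncanceling_Rem_pos N.
  have /and3P[lt le _] := N'.
  apply/existsP; exists (Ordinal (leq_trans (ltnW lt) le : _ < _.+1)).
  by apply/existsP; exists (Ordinal (le : _ < _.+1)).
apply/forallP=> i; apply/forallP=> j.
have [p [q [c [w [N Dw Dcore]]]]] := core j.
apply: leq_trans (occ_count_Rem i N); rewrite Dcore.
have Rl d : l <= occ_count i (Rem_letter phi d).
  rewrite /Rem_letter; move/forallP/(_ i)/forallP/(_ d.1): Sphi.
  by case: (d.2); rewrite ?count_inv_word.
apply: leq_trans (leq_occ_image_core _ _ c w Rl).
(* Here c w is the whole remnant of psi(a_j); each of the m generators occurs in it at least k
   times, so its length is at least m k. *)
rewrite leq_mul2l -[(size w).+1]/(size (c :: w)) -Dw -/(Rem psi j) -sum_occ_count.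
rewrite -[X in X * _ <= _]card_ord -sum_nat_const leq_sum ?orbT // => i' _.
by move/forallP/(_ i')/forallP/(_ j): Spsi.
Qed.

Lemma Sset_iter m l n (phi : endo m) : phi \in Sset l ->
  endo_iter phi n.+1 \in Sset (l ^ n.+1 * m ^ n).
Proof.
move=> S; elim: n => [|n IH]; first by rewrite expn1 muln1.
have -> : (l ^ n.+2 * m ^ n.+1 = l * (m * (l ^ n.+1 * m ^ n)))%N.
  by rewrite !expnS; lia.
exact: (Sset_comp (phi := phi) (psi := endo_iter phi n.+1)).
Qed.

(** * From occurrences in the remnants to Wagner tails *)

Section Counting.

Variables (m : nat) (psi : endo m).

Lemma occ_count_inside i p q (v : seq (letter m)) : q <= size v ->
  occ_count i (subword p q v) <=
    count (fun k => [&& (nth (i, true) v k).1 == i, p < k & k.+1 < q])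
      (iota 0 (size v)) + 2.
Proof.
move=> qv; set P := fun k => _.
have [qp|pq] := leqP q p.
  by move: qp; rewrite /subword -subn_eq0 => /eqP->; rewrite take0.
have -> : subword p q v = [seq nth (i, true) v k | k <- iota p (q - p)].
  by rewrite /subword map_nth_iota // leq_sub2r.
rewrite /occ_count count_map.
(* The only positions in range that are not inside are p and q - 1, whence the 2. The disjunct for k
   out of range makes the inclusion hold for all k and is removed again by [eq_in_count]. *)
have sub : subpred (preim (nth (i, true) v) (fun x => x.1 == i))
    (predU (fun k => P k || ~~ (p <= k < q)) (predU (pred1 p) (pred1 q.-1))).
  by move=> k /= ki; rewrite /P ki /=; lia.
apply: leq_trans (sub_count sub _) _.
apply: leq_trans (_ : count P (iota p (q - p)) +
   count (predU (pred1 p) (pred1 q.-1)) (iota p (q - p)) <= _).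
  rewrite -count_predUI; apply: leq_trans (leq_addr _ _).
  rewrite leq_eqVlt; apply/orP; left; apply/eqP/eq_in_count => k.
  by rewrite mem_iota /= subnKC ?(ltnW pq) // => ->; rewrite orbF.
apply: leq_add.
  have -> : size v = p + (q - p) + (size v - q) by lia.
  by rewrite !iotaD !count_cat add0n addnAC leq_addl.
apply: leq_trans (_ : count_mem p (iota p (q - p)) + count_mem q.-1 (iota p (q - p)) <= _).
  by rewrite -count_predUI leq_addr.
by rewrite !count_uniq_mem ?iota_uniq //; case: (_ \in _); case: (_ \in _).
Qed.

Lemma sum_occ_count_leq_W : has_remnant psi ->
  \sum_(i < m) occ_count i (Rem psi i) <= #|` W psi| + 2 * m.
Proof.
move=> remP.
pose inside i k := [&& (nth (i, true) (psi (gen i)) k).1 == i,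
  (Rem_pos psi i).1 < k & k.+1 < (Rem_pos psi i).2].
pose s := [seq (i, k) | i <- enum 'I_m,
                        k <- filter (inside i) (iota 0 (size (psi (gen i))))].
(* The label [Some o] keeps tails from different occurrences apart, even if the pairs of group
   elements coincide. *)
have us : uniq [seq (Some o, tail_at psi o) | o <- s].
  rewrite map_inj_uniq; last by move=> o o' [].
  apply: allpairs_uniq_dep; first exact: enum_uniq.
    by move=> i _; rewrite filter_uniq // iota_uniq.
  by move=> [i k] [i' k'] _ _ /= [-> ->].
have sW : {subset [seq (Some o, tail_at psi o) | o <- s] <= W psi}.
  move=> t /mapP[o /allpairsPdep[i [k [_ + ->]]] ->].
  rewrite mem_filter => /andP[/and3P[ik pk kq] ks].
  rewrite !inE; apply/andP; split; last by apply/and3P.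
  apply/orP; right.
  apply/imfsetP; exists (i, k) => //=; rewrite !inE /= ik andbT.
  by apply/allpairsPdep; exists i, k; rewrite mem_enum.
have := uniq_leq_size us sW; rewrite size_map => le_s.
apply: leq_trans (leq_add le_s (leqnn _)).
rewrite size_allpairs_dep sumnE big_map big_enum /=.
have -> : (2 * m = \sum_(i < m) 2)%N by rewrite sum_nat_const card_ord mulnC.
rewrite -big_split leq_sum //= => i _; rewrite size_filter.
apply: occ_count_inside; by have /and3P[] := noncanceling_Rem remP i.
Qed.

End Counting.

Theorem theorem6 (m l n : nat) (m_gt0 : 0 < m) (l_gt0 : 0 < l) (n_gt0 : 0 < n)
    (phi : endo m) (phiS : phi \in Sset l) :
  l ^ n * m ^ n <= #|` W (endo_iter phi n)| + 2 * m.
Proof.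
case: n n_gt0 => // n _; have /andP[rem occ] := Sset_iter n phiS.
apply: leq_trans (sum_occ_count_leq_W rem).
(* The last factor m comes from summing the diagonal bounds, a_i in the remnant of a_i, over all m
   generators. *)
have -> : (l ^ n.+1 * m ^ n.+1 = \sum_(i < m) l ^ n.+1 * m ^ n)%N.
  by rewrite sum_nat_const card_ord [m ^ _.+1]expnS mulnCA.
by apply: leq_sum => i _; move/forallP/(_ i)/forallP/(_ i): occ.
Qed.
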